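(* Up to isomorphism of real algebras, the only Euclidean Hurwitz algebras are $\mathbb{R}$, $\mathbb{C}$, $\mathbb{H}$ and $\mathbb{O}$. That is: $\mathbb{R},\mathbb{C},\mathbb{H},\mathbb{O}$ (on $\mathbb{E}^1,\mathbb{E}^2,\mathbb{E}^4,\mathbb{E}^8$ respectively, with their standard multiplications) are Euclidean Hurwitz algebras, and every Euclidean Hurwitz algebra over $\mathbb{E}^n$, $n\ge 1$, is isomorphic as a real algebra to one of $\mathbb{R},\mathbb{C},\mathbb{H},\mathbb{O}$.
   Context: $\mathbb{E}^n$ denotes the real vector space $\mathbb{R}^n$ with the standard Euclidean norm $\|x\|=\sqrt{x_1^2+\cdots+x_n^2}$ and standard orthonormal basis $e_1,\dots,e_n$. A Euclidean Hurwitz algebra over $\mathbb{E}^n$ is $\mathbb{E}^n$ together with a multiplication $\mathbb{E}^n\times\mathbb{E}^n\to\mathbb{E}^n$, $(x,y)\mapsto xy$, such that: (1) $x(y+z)=xy+xz$ and $(y+z)x=yx+zx$ for all $x,y,z$; (2) $a(xy)=(ax)y=x(ay)$ for all $x,y\in\mathbb{E}^n$, $a\in\mathbb{R}$, where the scalar $a$ is identified with the vector $(a,0,\dots,0)$, so that multiplication by $(a,0,\dots,0)$ agrees with scalar multiplication by $a$; in particular $e_1=1$ is a two-sided unit (this axiom is equivalent to homogeneity of the multiplication together with existence of a unit); (3) $\|xy\|=\|x\|\,\|y\|$ for all $x,y$. Multiplication is not assumed commutative or associative. $\mathbb{C}$ is the complex numbers; $\mathbb{H}$ is Hamilton's quaternions,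 with orthonormal basis $1,i,j,k$ and $i^2=j^2=k^2=ijk=-1$; $\mathbb{O}$ is the octonions, the 8-dimensional real algebra which can be described as pairs $(a,b)\in\mathbb{H}^2$ with $(a,b)(c,d)=(ac-\bar d b,\ da+b\bar c)$, where the bar is quaternion conjugation, and norm $\sqrt{\|a\|^2+\|b\|^2}$. *)

(* Defs.v *)
From mathcomp Require Import all_boot all_order all_algebra.
From mathcomp Require Import reals.
From mathcomp Require Import complex.

Set Implicit Arguments.
Unset Strict Implicit.
Unset Printing Implicit Defensive.

Import GRing.Theory.
Local Open Scope ring_scope.

(* E^n is ['rV[R]_n] with [R : realType]. The library's canonical norm on
   matrices is the sup norm, so the Euclidean norm is defined here. *)
Definition enorm (R : realType) (n : nat) (x : 'rV[R]_n) : R :=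
  Num.sqrt (\sum_(i < n) x 0 i ^+ 2).

(* The vector (a, 0, ..., 0) with which the scalar a is identified. *)
Definition scalar_vec (R : realType) (n : nat) (a : R) : 'rV[R]_n :=
  \row_(i < n) (if val i == 0%N then a else 0).

(* Neither commutativity nor associativity is required. *)
Record euclidean_hurwitz (R : realType) (n : nat)
    (mul : 'rV[R]_n -> 'rV[R]_n -> 'rV[R]_n) : Prop := EuclideanHurwitz {
  hurwitz_mulDr : forall x y z, mul x (y + z) = mul x y + mul x z;
  hurwitz_mulDl : forall x y z, mul (y + z) x = mul y x + mul z x;
  hurwitz_scaleAl : forall (a : R) x y, a *: mul x y = mul (a *: x) y;
  hurwitz_scaleAr : forall (a : R) x y, a *: mul x y = mul x (a *: y);
  hurwitz_scalarl : forall (a : R) x, mul (scalar_vec n a) x = a *: x;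
  hurwitz_scalarr : forall (a : R) x, mul x (scalar_vec n a) = a *: x;
  hurwitz_norm : forall x y, enorm (mul x y) = enorm x * enorm y
}.

Definition algebra_isomorphic (R : realType) (n m : nat)
    (mul1 : 'rV[R]_n -> 'rV[R]_n -> 'rV[R]_n)
    (mul2 : 'rV[R]_m -> 'rV[R]_m -> 'rV[R]_m) : Prop :=
  exists f : {linear 'rV[R]_n -> 'rV[R]_m},
    bijective f /\ forall x y, f (mul1 x y) = mul2 (f x) (f y).

Definition real_mul (R : realType) (x y : 'rV[R]_1) : 'rV[R]_1 :=
  \row_(i < 1) (x 0 0 * y 0 0).

Definition complex_mul (R : realType) (x y : 'rV[R]_2) : 'rV[R]_2 :=
  let z : R[i] := (x 0 0 +i* x 0 1)%C * (y 0 0 +i* y 0 1)%C in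
  \row_(i < 2) [:: complex.Re z; complex.Im z]`_i.

(* Coordinates with respect to the basis 1, i, j, k; the product is the
   associative bilinear one with unit 1 determined by
   i^2 = j^2 = k^2 = ijk = -1, see [quaternion_relations]. *)
Definition quaternion_mul (R : realType) (x y : 'rV[R]_4) : 'rV[R]_4 :=
  \row_(l < 4)
   [:: x 0 0 * y 0 0 - x 0 1 * y 0 1 - x 0 2 * y 0 2 - x 0 3 * y 0 3;
       x 0 0 * y 0 1 + x 0 1 * y 0 0 + x 0 2 * y 0 3 - x 0 3 * y 0 2;
       x 0 0 * y 0 2 - x 0 1 * y 0 3 + x 0 2 * y 0 0 + x 0 3 * y 0 1;
       x 0 0 * y 0 3 + x 0 1 * y 0 2 - x 0 2 * y 0 1 + x 0 3 * y 0 0]`_l.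

Definition quaternion_conj (R : realType) (x : 'rV[R]_4) : 'rV[R]_4 :=
  \row_(l < 4) [:: x 0 0; - x 0 1; - x 0 2; - x 0 3]`_l.

(* A pair (a, b) of quaternions is encoded as [row_mx a b]. *)
Definition octonion_mul (R : realType) (x y : 'rV[R]_(4 + 4)) :
    'rV[R]_(4 + 4) :=
  let a := lsubmx x in let b := rsubmx x in
  let c := lsubmx y in let d := rsubmx y in
  row_mx (quaternion_mul a c - quaternion_mul (quaternion_conj d) b)
         (quaternion_mul d a + quaternion_mul b (quaternion_conj c)).

Lemma quaternion_relations (R : realType)
    (i := delta_mx 0 1 : 'rV[R]_4) (j := delta_mx 0 2 : 'rV[R]_4)
    (k := delta_mx 0 3 : 'rV[R]_4) (minus1 := - delta_mx 0 0 : 'rV[R]_4) :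
  [/\ quaternion_mul i i = minus1, quaternion_mul j j = minus1,
      quaternion_mul k k = minus1 &
      quaternion_mul (quaternion_mul i j) k = minus1].
Proof.
by split; apply/rowP; case; case=> [|[|[|[|]]]] // lt_l4;
  rewrite !mxE /= ?(mulr0, mul0r, mulr1, addr0, add0r, subr0, sub0r, oppr0).
Qed.

(* Main.v *)
Require Import Defs.
From mathcomp Require Import all_boot all_order all_algebra.
From mathcomp Require Import reals ring lra.

Set Implicit Arguments.
Unset Strict Implicit.
Unset Printing Implicit Defensive.

Import Order.TTheory GRing.Theory Num.Theory.
Local Open Scope ring_scope.

(** Polarizing |xy| = |x| |y| shows that, with the conjugation
    hconj x = 2<x,1>1 - x, left and right multiplication by hconj x are the
    adjoints of left and right multiplication by x. The laws of
    conjugation (for instance the polarized form of hconj x (x y) = |x|^2 y)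
    follow by pairing both sides with an arbitrary vector.

    Let B be a subalgebra of a Hurwitz algebra A and u a unit vector
    orthogonal to B. The adjoint identities determine every product of
    elements of B + Bu ([mul_cross_right], [mul_cross_left],
    [mul_cross_cross]): they are exactly those of the Cayley-Dickson double
    of B, and Bu is an isometric copy of B orthogonal to B. So if B is not
    all of A, then the double of B embeds isometrically in A
    ([embedding_iso_or_double]).

    In the double of B, the squared norm of (a,b)(c,d) is the product of the
    squared norms plus 2<a, d'(bc') - (d'b)c'>, where ' is conjugation
    ([dot_cayley_dickson]). Hence the double of B is a Hurwitz algebra if and
    only if B is associative. Starting from the reals, doubling gives the
    complex numbers, the quaternions and the octonions; since the first three
    are associative, all four are Hurwitz algebras.

    Conversely, given A, embed the reals as the multiples of the unit and
    double as long as the embedding is not onto. This stops at the octonions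
    at the latest: if they sat properly inside A, their double would have a
    multiplicative norm, so the octonions would be associative; but
    associativity of a double forces commutativity of the algebra that is
    doubled ([cayley_dickson_assoc_comm]), and the quaternions are not
    commutative. *)

(** * Inner product and conjugation *)

Section Dot.
Variables (R : realType) (n : nat).
Implicit Types (x y z : 'rV[R]_n) (a : R).

Definition dot x y : R := (x *m y^T) 0 0.

Lemma dotE x y : dot x y = \sum_(i < n) x 0 i * y 0 i.
Proof. by rewrite /dot mxE; apply: eq_bigr => i _; rewrite mxE. Qed.

Lemma dotC x y : dot x y = dot y x.
Proof. by rewrite !dotE; apply: eq_bigr => i _; rewrite mulrC. Qed.

Lemma dotDl x y z : dot (x + y) z = dot x z + dot y z.
Proof. by rewrite /dot mulmxDl mxE. Qed.

Lemma dotZl a x y : dot (a *: x) y = a * dot x y.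
Proof. by rewrite /dot -scalemxAl mxE. Qed.

Lemma dotNl x y : dot (- x) y = - dot x y.
Proof. by rewrite /dot mulNmx mxE. Qed.

Lemma dotDr x y z : dot z (x + y) = dot z x + dot z y.
Proof. by rewrite dotC dotDl !(dotC z). Qed.

Lemma dotZr a x y : dot x (a *: y) = a * dot x y.
Proof. by rewrite dotC dotZl dotC. Qed.

Lemma dotNr x y : dot x (- y) = - dot x y.
Proof. by rewrite dotC dotNl dotC. Qed.

Definition dot_linear := (dotDl, dotDr, dotZl, dotZr, dotNl, dotNr).

Lemma dot_ge0 x : 0 <= dot x x.
Proof. by rewrite dotE; apply: sumr_ge0 => i _; rewrite -expr2 sqr_ge0. Qed.

Lemma dot_eq0 x : (dot x x == 0) = (x == 0).
Proof.
apply/idP/eqP => [|->]; last by rewrite /dot mul0mx mxE.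
rewrite dotE psumr_eq0 => [/allP x0|i _]; last by rewrite -expr2 sqr_ge0.
apply/rowP => i; rewrite mxE; apply/eqP; rewrite -sqrf_eq0 expr2.
exact: (implyP (x0 i (mem_index_enum i))).
Qed.

Lemma dot_inj x y : (forall z, dot x z = dot y z) -> x = y.
Proof.
move=> xy; apply/eqP; rewrite -subr_eq0 -dot_eq0.
by rewrite dotDl dotNl xy subrr.
Qed.

Lemma enormE x : enorm x = Num.sqrt (dot x x).
Proof. by rewrite /enorm dotE; under eq_bigr do rewrite expr2. Qed.

Lemma enorm_eqP x y z :
  (enorm x = enorm y * enorm z) <-> (dot x x = dot y y * dot z z).
Proof.
rewrite !enormE -sqrtrM ?dot_ge0 //; split=> [|-> //].
move=> /(congr1 (fun r => r ^+ 2)).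
by rewrite !sqr_sqrtr ?mulr_ge0 ?dot_ge0.
Qed.

Lemma scalar_vecE a : scalar_vec n a = a *: scalar_vec n 1.
Proof. by apply/rowP => i; rewrite !mxE; case: ifP; rewrite ?mulr1 ?mulr0. Qed.

Lemma dot_one : (0 < n)%N -> dot (scalar_vec n 1) (scalar_vec n 1) = 1.
Proof.
move=> n_gt0; rewrite dotE (bigD1 (Ordinal n_gt0)) //=.
rewrite big1 ?mxE ?mulr1 ?addr0 //.
by move=> i i0; rewrite mxE ifN ?mul0r.
Qed.

(** Locked, because otherwise rewriting with distributivity sees through
    [hconj] and splits the difference that defines it. *)
Definition hconj x :=
  locked ((2 * dot x (scalar_vec n 1)) *: scalar_vec n 1 - x).

Lemma hconjE x : hconj x = (2 * dot x (scalar_vec n 1)) *: scalar_vec n 1 - x.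
Proof. by rewrite /hconj -lock. Qed.

Lemma hconjD x y : hconj (x + y) = hconj x + hconj y.
Proof. by rewrite !hconjE dotDl mulrDr scalerDl opprD addrACA. Qed.

Lemma hconjZ a x : hconj (a *: x) = a *: hconj x.
Proof. by rewrite !hconjE dotZl mulrCA scalerBr scalerA. Qed.

Lemma hconj0 : hconj 0 = 0.
Proof. by rewrite -[X in hconj X](scale0r 0) hconjZ scale0r. Qed.

Lemma hconjK : (0 < n)%N -> involutive hconj.
Proof.
move=> n_gt0 x; rewrite {1}hconjE {1}hconjE !dot_linear dot_one //.
rewrite hconjE opprB addrCA -scalerBl addrC.
rewrite [X in X *: _](_ : _ = 0) ?scale0r ?add0r //; ring.
Qed.

Lemma hconj_one : (0 < n)%N -> hconj (scalar_vec n 1) = scalar_vec n 1.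
Proof.
by move=> n_gt0; rewrite hconjE dot_one // mulr1 scaler_nat mulr2n addrK.
Qed.

Lemma hconj_orth x : dot x (scalar_vec n 1) = 0 -> hconj x = - x.
Proof. by rewrite hconjE => ->; rewrite mulr0 scale0r sub0r. Qed.

Lemma dot_hconj x y : dot x (hconj y) = dot (hconj x) y.
Proof. rewrite !hconjE !dot_linear (dotC (scalar_vec n 1) y); ring. Qed.

End Dot.

(** * Adjoint identities in a Hurwitz algebra *)

Section HurwitzAlgebra.
Variables (R : realType) (n : nat) (mul : 'rV[R]_n -> 'rV[R]_n -> 'rV[R]_n).
Hypotheses (n_gt0 : (0 < n)%N) (H : euclidean_hurwitz mul).
Local Infix "**" := mul (at level 40, left associativity).
Local Notation one := (scalar_vec n 1).
Implicit Types (x y z w u a b c d : 'rV[R]_n).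

Lemma hmulDl x y z : (x + y) ** z = x ** z + y ** z.
Proof. exact: (hurwitz_mulDl H). Qed.
Lemma hmulDr x y z : z ** (x + y) = z ** x + z ** y.
Proof. exact: (hurwitz_mulDr H). Qed.
Lemma hmulZl (k : R) x y : (k *: x) ** y = k *: (x ** y).
Proof. by rewrite (hurwitz_scaleAl H). Qed.
Lemma hmulZr (k : R) x y : x ** (k *: y) = k *: (x ** y).
Proof. by rewrite (hurwitz_scaleAr H). Qed.
Lemma hmulNl x y : (- x) ** y = - (x ** y).
Proof. by rewrite -scaleN1r hmulZl scaleN1r. Qed.
Lemma hmulNr x y : x ** (- y) = - (x ** y).
Proof. by rewrite -scaleN1r hmulZr scaleN1r. Qed.
Lemma hmul0l x : 0 ** x = 0.
Proof. by rewrite -[X in X ** _](scale0r 0) hmulZl scale0r. Qed.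
Lemma hmul0r x : x ** 0 = 0.
Proof. by rewrite -[X in _ ** X](scale0r 0) hmulZr scale0r. Qed.
Lemma hmul1l x : one ** x = x.
Proof. by rewrite (hurwitz_scalarl H) scale1r. Qed.
Lemma hmul1r x : x ** one = x.
Proof. by rewrite (hurwitz_scalarr H) scale1r. Qed.

(** Right multiplications as matrices, so that embeddings can be assembled as
    block matrices. *)
Lemma hmulr_mx u : exists P : 'M[R]_n, forall x, x *m P = x ** u.
Proof.
exists (\matrix_l (delta_mx 0 l ** u)) => x.
rewrite [in RHS](row_sum_delta x) mulmx_sum_row.
rewrite (big_morph (fun y => y ** u) (fun y z => hmulDl y z u) (hmul0l u)).
by apply: eq_bigr => l _; rewrite rowK hmulZl.
Qed.

Lemma dotM x y : dot (x ** y) (x ** y) = dot x x * dot y y.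
Proof. by apply/enorm_eqP; exact: (hurwitz_norm H). Qed.

Lemma dotMl x y z : dot (x ** y) (x ** z) = dot x x * dot y z.
Proof.
have := dotM x (y + z); rewrite hmulDr !dot_linear !dotM.
rewrite (dotC (x ** z)) (dotC z y) => E; lra.
Qed.

(** Polarization of [dotMl] in the first factor; every later identity in the
    algebra comes from this one. *)
Lemma dotMM x y z w :
  dot (x ** y) (z ** w) + dot (x ** w) (z ** y) = 2 * (dot x z * dot y w).
Proof.
have := dotMl (x + z) y w; rewrite !hmulDl !dot_linear !dotMl.
rewrite (dotC (z ** y)) (dotC z x) => E; lra.
Qed.

(** Take the third factor in [dotMM] to be 1. *)
Lemma dot_adjl x y z : dot (x ** y) z = dot y (hconj x ** z).
Proof.
have := dotMM x y one z.
rewrite hconjE hmulDl hmulNl hmulZl !hmul1l !dot_linear (dotC y (x ** z)) => E.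
lra.
Qed.

Lemma dot_adjr x y z : dot (y ** x) z = dot y (z ** hconj x).
Proof.
have := dotMM y x z one.
rewrite hconjE hmulDr hmulNr hmulZr !hmul1r !dot_linear => E; lra.
Qed.

(** The weak form of associativity that survives in a Hurwitz algebra: by
    adjunction, pairing with w turns it into [dotMM]. *)
Lemma hconj_mull x y z :
  hconj x ** (y ** z) + hconj y ** (x ** z) = (2 * dot x y) *: z.
Proof.
apply: dot_inj => w; rewrite dotDl dotZl !dot_adjl !hconjK // -!dot_adjl.
rewrite [RHS](_ : _ = 2 * (dot y x * dot z w)); last by rewrite (dotC y); ring.
by rewrite (dotC (x ** z)) dotMM.
Qed.

Lemma hconj_mulr x y z :
  (z ** x) ** hconj y + (z ** y) ** hconj x = (2 * dot x y) *: z.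
Proof.
apply: dot_inj => w; rewrite dotDl dotZl !dot_adjr !hconjK // -!dot_adjr.
rewrite [RHS](_ : _ = 2 * (dot z w * dot x y)); last by ring.
by rewrite dotMM.
Qed.

(** Moving factors across the inner product reduces both <(xy)', z> and
    <y'x', z> to <y, x'z'>, where ' is conjugation. *)
Lemma hconjM x y : hconj (x ** y) = hconj y ** hconj x.
Proof.
apply: dot_inj => z.
rewrite -dot_hconj dot_adjl dot_adjl hconjK //.
by rewrite [RHS]dotC dot_adjr.
Qed.

(** * Products with a vector orthogonal to a subalgebra *)

(** The orthogonality hypotheses hold when a, b, c, d lie in a subalgebra
    that contains 1 and is orthogonal to u. *)
Section Orthogonal.
Variable u : 'rV[R]_n.
Hypotheses (u_one : dot u one = 0) (u_unit : dot u u = 1).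

(** [hconj_mull] for the orthogonal vectors [hconj a] and u, whose right-hand
    side vanishes. *)
Lemma mul_orth_swap a z : dot a u = 0 -> a ** (u ** z) = u ** (hconj a ** z).
Proof.
move=> au; have := hconj_mull (hconj a) u z.
rewrite hconjK // -dot_hconj hconj_orth // dotNr au oppr0 mulr0 scale0r.
by rewrite hmulNl => /eqP; rewrite subr_eq0 => /eqP.
Qed.

Lemma mul_orth_conj a : dot a u = 0 -> a ** u = u ** hconj a.
Proof. by move=> au; have := mul_orth_swap one au; rewrite !hmul1r. Qed.

(** The reversal of a and d comes from conjugating twice: with ' for
    conjugation, a(du) = a(ud') = u(a'd') = u(da)' = (da)u. *)
Lemma mul_cross_right a d :
  dot a u = 0 -> dot d u = 0 -> dot (d ** a) u = 0 ->
  a ** (d ** u) = (d ** a) ** u.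
Proof.
by move=> au du dau; rewrite !mul_orth_conj // hconjM mul_orth_swap.
Qed.

Lemma mul_cross_left b c : dot c u = 0 -> (b ** u) ** c = (b ** hconj c) ** u.
Proof.
move=> cu; have := hconj_mulr u (hconj c) b.
rewrite hconjK // dot_hconj (hconj_orth u_one) dotNl dotC cu.
rewrite oppr0 mulr0 scale0r.
by rewrite hmulNr => /eqP; rewrite subr_eq0 => /eqP.
Qed.

Lemma mul_orthK z : (z ** u) ** u = - z.
Proof.
have := hconj_mulr u u z; rewrite u_unit hconj_orth // hmulNr mulr1.
rewrite -mulr2n -scaler_nat => E.
have two_neq0 : 2 != 0 :> R by rewrite pnatr_eq0.
by rewrite -[in RHS](scalerI two_neq0 E) opprK.
Qed.

(** [hconj_mulr] for u and d u, where d u is again orthogonal to 1, so that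
    its conjugate is its opposite, and <u, d u> = <1, d>. *)
Lemma mul_cross_cross b d :
  dot b u = 0 -> dot d u = 0 -> dot (d ** b) u = 0 ->
  (b ** u) ** (d ** u) = - (hconj d ** b).
Proof.
move=> bu du dbu; have := hconj_mulr u (d ** u) b.
have -> : hconj (d ** u) = - (d ** u).
  by rewrite hconj_orth // dot_adjr hmul1l hconj_orth // dotNr du oppr0.
have -> : dot u (d ** u) = dot d one.
  rewrite dotC dot_adjr hconj_orth // hmulNr -{1}[u]hmul1l.
  by rewrite mul_orthK opprK.
rewrite (hconj_orth u_one) !hmulNr (mul_cross_right bu du dbu).
rewrite mul_orthK opprK => E.
by rewrite hconjE hmulDl hmulNl hmulZl hmul1l -E addrK opprK.
Qed.

End Orthogonal.
End HurwitzAlgebra.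

(** * Cayley-Dickson doubling *)

Section Doubling.
Variables (R : realType) (m : nat) (mul : 'rV[R]_m -> 'rV[R]_m -> 'rV[R]_m).
Implicit Types (a b c d : 'rV[R]_m).

Definition cayley_dickson (x y : 'rV[R]_(m + m)) : 'rV[R]_(m + m) :=
  let a := lsubmx x in let b := rsubmx x in
  let c := lsubmx y in let d := rsubmx y in
  row_mx (mul a c - mul (hconj d) b) (mul d a + mul b (hconj c)).

Lemma cayley_dicksonE a b c d :
  cayley_dickson (row_mx a b) (row_mx c d) =
  row_mx (mul a c - mul (hconj d) b) (mul d a + mul b (hconj c)).
Proof. by rewrite /cayley_dickson !row_mxKl !row_mxKr. Qed.

Lemma dot_row_mx a b c d :
  dot (row_mx a b) (row_mx c d) = dot a c + dot b d.
Proof. by rewrite /dot tr_row_mx mul_row_col mxE. Qed.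

Lemma scalar_vec_row_mx (k : R) :
  (0 < m)%N -> scalar_vec (m + m) k = row_mx (scalar_vec m k) 0.
Proof.
move=> m_gt0; apply/rowP => l; rewrite mxE -[l]splitK.
case: (split l) => j /=; rewrite ?row_mxEl ?row_mxEr !mxE //=.
by rewrite addn_eq0 (gtn_eqF m_gt0).
Qed.

Hypotheses (m_gt0 : (0 < m)%N) (H : euclidean_hurwitz mul).

(** Let ' be conjugation. The cross terms are -2<ac, d'b> and 2<da, bc'>; once
    all factors but a are moved to the right of the inner product, they add up
    to an associator. *)
Lemma dot_cayley_dickson a b c d :
  let p := cayley_dickson (row_mx a b) (row_mx c d) in
  dot p p = (dot a a + dot b b) * (dot c c + dot d d)
    + 2 * (dot a (mul (hconj d) (mul b (hconj c)))
           - dot a (mul (mul (hconj d) b) (hconj c))).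
Proof.
have N (x : 'rV[R]_m) : dot (hconj x) (hconj x) = dot x x.
  by rewrite dot_hconj hconjK.
rewrite /= cayley_dicksonE dot_row_mx !dot_linear !(dotM H) !N.
rewrite (dotC (mul (hconj d) b)) (dotC (mul b (hconj c))).
rewrite (dot_adjr H c) (dot_adjl H d); ring.
Qed.

Lemma cayley_dickson_norm_assoc :
  (forall x y, dot (cayley_dickson x y) (cayley_dickson x y)
     = dot x x * dot y y) <-> associative mul.
Proof.
split=> [norm b' b c'|assoc x y]; last first.
  rewrite -[x]hsubmxK -[y]hsubmxK dot_cayley_dickson assoc subrr mulr0 addr0.
  by rewrite !dot_row_mx.
apply: dot_inj => a.
have := norm (row_mx a b) (row_mx (hconj c') (hconj b')).
rewrite dot_cayley_dickson !dot_row_mx !hconjK // !(dotC _ a) => E; lra.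
Qed.

Lemma cayley_dickson_hurwitz :
  associative mul -> euclidean_hurwitz cayley_dickson.
Proof.
move=> /cayley_dickson_norm_assoc norm.
have D := (hmulDl H, hmulDr H); have Z := (hmulZl H, hmulZr H).
split.
- move=> x y z; rewrite /cayley_dickson add_row_mx !linearD /= !hconjD !D.
  by rewrite opprD addrACA [X in row_mx _ X]addrACA.
- move=> x y z; rewrite /cayley_dickson add_row_mx !linearD /= !D.
  by rewrite opprD addrACA [X in row_mx _ X]addrACA.
- move=> k x y; rewrite /cayley_dickson scale_row_mx !linearZ /= !Z.
  by rewrite scalerBr scalerDr.
- move=> k x y; rewrite /cayley_dickson scale_row_mx !linearZ /= !hconjZ !Z.
  by rewrite scalerBr scalerDr.
- move=> k x; rewrite scalar_vec_row_mx // -[x]hsubmxK cayley_dicksonE.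
  rewrite scale_row_mx (hurwitz_scalarl H) (hurwitz_scalarr H).
  by rewrite !(hmul0l H, hmul0r H) subr0 addr0.
- move=> k x; rewrite scalar_vec_row_mx // -[x]hsubmxK cayley_dicksonE.
  rewrite scale_row_mx (hurwitz_scalarr H).
  rewrite scalar_vecE hconjZ hconj_one // hconj0 !Z !(hmul0l H).
  by rewrite (hmul1r H) subr0 add0r.
- by move=> x y; apply/enorm_eqP.
Qed.

(** With u = (0,1), associativity equates a(cu) = (ca)u and (ac)u. *)
Lemma cayley_dickson_assoc_comm : associative cayley_dickson -> commutative mul.
Proof.
move=> assoc a c.
have := assoc (row_mx a 0) (row_mx c 0) (row_mx 0 (scalar_vec m 1)).
rewrite !cayley_dicksonE => /(congr1 rsubmx); rewrite ?row_mxKr ?row_mxKl.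
by rewrite !(hmul0l H, hmul0r H, subr0, addr0, add0r, hmul1l H) => ->.
Qed.

End Doubling.

(** * Isometric embeddings *)

Section Embedding.
Variables (R : realType) (m n : nat).
Variables (mulB : 'rV[R]_m -> 'rV[R]_m -> 'rV[R]_m).
Variables (mulA : 'rV[R]_n -> 'rV[R]_n -> 'rV[R]_n).

(** The linear map x |-> x M as a matrix: its transpose is then the adjoint,
    hence a left inverse of the isometry. *)
Definition hurwitz_embedding (M : 'M[R]_(m, n)) :=
  [/\ forall x y, mulB x y *m M = mulA (x *m M) (y *m M),
      scalar_vec m 1 *m M = scalar_vec n 1 &
      forall x y, dot (x *m M) (y *m M) = dot x y].

Variable M : 'M[R]_(m, n).
Hypothesis embM : hurwitz_embedding M.

Lemma embedding_trK (x : 'rV[R]_m) : x *m M *m M^T = x.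
Proof.
case: embM => _ _ iso; apply: dot_inj => y.
by rewrite -[RHS]iso /dot trmx_mul !mulmxA.
Qed.

Lemma embedding_iso : M^T *m M = 1%:M -> algebra_isomorphic mulA mulB.
Proof.
move=> MtM; have trMK x : x *m M^T *m M = x by rewrite -mulmxA MtM mulmx1.
exists (mulmxr M^T : {linear 'rV[R]_n -> 'rV[R]_m}); split=> [|x y] /=.
  by exists (mulmxr M) => x /=; rewrite ?trMK ?embedding_trK.
case: embM => mulM _ _; rewrite -{1}[x]trMK -{1}[y]trMK -mulM.
exact: embedding_trK.
Qed.

(** The matrix M^T M projects orthogonally onto the range of M, so a nonzero
    vector in the image of 1 - M^T M, once normalized, is orthogonal to that
    range. *)
Lemma embedding_orth_unit :
  M^T *m M != 1%:M -> exists2 u, dot u u = 1 & forall x, dot (x *m M) u = 0.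
Proof.
rewrite eq_sym -subr_eq0 => /rowV0Pn[w /submxP[v ->]].
set u := v *m _ => u_neq0; have u_gt0 : 0 < dot u u.
  by rewrite lt_neqAle dot_ge0 eq_sym dot_eq0 u_neq0.
exists ((Num.sqrt (dot u u))^-1 *: u) => [|x]; rewrite !dot_linear.
  rewrite mulrA -expr2 exprVn sqr_sqrtr ?dot_ge0 // mulVf //.
  by rewrite gt_eqF.
suff xu : dot (x *m M) u = 0 by rewrite xu mulr0.
rewrite dotC /dot /u trmx_mul.
have -> : v *m (1%:M - M^T *m M) *m (M^T *m x^T)
    = v *m (M^T - M^T *m (M *m M^T)) *m x^T.
  by rewrite !mulmxBr !mulmxBl mulmx1 !mulmxA.
have -> : M *m M^T = 1%:M.
  by apply/row_matrixP => l; rewrite row1 rowE mulmxA embedding_trK.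
by rewrite mulmx1 subrr mulmx0 mul0mx mxE.
Qed.

Lemma embedding_hconj (x : 'rV[R]_m) : hconj x *m M = hconj (x *m M).
Proof.
case: embM => _ M1 iso.
by rewrite !hconjE -M1 iso mulmxBl -scalemxAl.
Qed.

End Embedding.

Section EmbeddingDouble.
Variables (R : realType) (m n : nat).
Variables (mulB : 'rV[R]_m -> 'rV[R]_m -> 'rV[R]_m).
Variables (mulA : 'rV[R]_n -> 'rV[R]_n -> 'rV[R]_n).
Hypotheses (m_gt0 : (0 < m)%N) (n_gt0 : (0 < n)%N).
Hypotheses (HA : euclidean_hurwitz mulA).

(** When the range B of M is proper, pick a unit vector u orthogonal to it;
    then (a, b) |-> a + b u embeds the double of B. *)
Lemma embedding_iso_or_double :
  (exists M, hurwitz_embedding mulB mulA M) ->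
  algebra_isomorphic mulA mulB \/
  exists M, hurwitz_embedding (cayley_dickson mulB) mulA M.
Proof.
case=> M embM; have [MtM|] := eqVneq (M^T *m M) 1%:M.
  by left; exact: embedding_iso MtM.
move=> /(embedding_orth_unit embM)[u u_unit u_orth]; right.
have [mulM M1 iso] := embM; have cM := embedding_hconj embM.
have u_one : dot u (scalar_vec n 1) = 0 by rewrite -M1 dotC.
have mulM_orth x y : dot (mulA (x *m M) (y *m M)) u = 0 by rewrite -mulM.
have [P mulP] := hmulr_mx HA u.
exists (col_mx M (M *m P)); split=> [x y||x y].
- rewrite -[x]hsubmxK -[y]hsubmxK cayley_dicksonE !mul_row_col !mulmxA !mulP.
  rewrite !(mulmxDl, mulNmx, mulM, cM) !(hmulDl HA) !(hmulDr HA).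
  rewrite (mul_cross_right n_gt0 HA u_one) //.
  rewrite (mul_cross_left n_gt0 HA u_one) //.
  rewrite (mul_cross_cross n_gt0 HA u_one) //.
  by rewrite -!addrA; congr (_ + _); rewrite addrC -!addrA addrCA addrC -!addrA.
- by rewrite scalar_vec_row_mx // mul_row_col mul0mx addr0.
- rewrite -[x]hsubmxK -[y]hsubmxK !mul_row_col !mulmxA !mulP !dot_row_mx.
  have cross a b : dot (a *m M) (mulA (b *m M) u) = 0.
    by rewrite dotC (dot_adjl HA) -cM dotC mulM_orth.
  rewrite !dot_linear (dotC (mulA _ u) (_ *m M)) !cross !iso addr0 add0r.
  rewrite (dot_adjr HA) (hconj_orth u_one) (hmulNr HA).
  by rewrite (mul_orthK n_gt0 HA) // opprK iso.
Qed.

End EmbeddingDouble.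

(** The isometric embedding makes the norm of the double multiplicative. *)
Lemma cayley_dickson_embedding_assoc (R : realType) (m n : nat)
    (mulB : 'rV[R]_m -> 'rV[R]_m -> 'rV[R]_m)
    (mulA : 'rV[R]_n -> 'rV[R]_n -> 'rV[R]_n) :
  (0 < m)%N -> euclidean_hurwitz mulB -> euclidean_hurwitz mulA ->
  (exists M, hurwitz_embedding (cayley_dickson mulB) mulA M) ->
  associative mulB.
Proof.
move=> m_gt0 HB HA [M [mulM _ iso]]; apply/(cayley_dickson_norm_assoc m_gt0 HB).
by move=> x y; rewrite -iso mulM (dotM HA) !iso.
Qed.

(** * The four algebras *)

Section Classical.
Variable R : realType.

Lemma hconj_coord m (x : 'rV[R]_m.+1) l :
  hconj x 0 l = if l == 0 then x 0 0 else - x 0 l.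
Proof.
have -> : hconj x 0 l = 2 * x 0 0 * (l == 0)%:R - x 0 l.
  rewrite hconjE !mxE /dot (_ : (x *m _) 0 0 = x 0 0).
    by rewrite -[l == 0]/(val l == 0%N); case: ifP.
  rewrite mxE (bigD1 0) //= big1 ?mxE ?mulr1 ?addr0 // => i /negPf i0.
  by rewrite !mxE [val i == _]i0 mulr0.
case: eqP => [->|_]; rewrite ?mulr0 ?sub0r // mulr1; ring.
Qed.

Lemma real_hurwitz : euclidean_hurwitz (@real_mul R).
Proof.
split; try by move=> *; apply/rowP => l; rewrite !ord1 !mxE /=; ring.
move=> x y; apply/enorm_eqP; rewrite !dotE !big_ord1 !mxE; ring.
Qed.

Lemma quaternion_conjE : @quaternion_conj R = @hconj R 4.
Proof.
apply/boolp.funext => x; apply/rowP => l; rewrite hconj_coord !mxE.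
by case: l => [[|[|[|[|//]]]]] l4 /=; congr (- x 0 _) || congr (x 0 _);
  apply/val_inj.
Qed.

Lemma octonion_mulE : @octonion_mul R = cayley_dickson (@quaternion_mul R).
Proof. by rewrite /octonion_mul quaternion_conjE. Qed.

Lemma complex_mulE : @complex_mul R = cayley_dickson (@real_mul R).
Proof.
apply/boolp.funext => x; apply/boolp.funext => y; apply/(@rowP R (1 + 1)) => l.
have e0 : lshift 1 (0 : 'I_1) = 0 :> 'I_2 by apply/val_inj.
have e1 : rshift 1 (0 : 'I_1) = 1 :> 'I_2 by apply/val_inj.
rewrite /cayley_dickson; case: (split_ordP l) => j ->; rewrite (ord1 j) /=;
  rewrite ?row_mxEl ?row_mxEr !mxE !hconj_coord !mxE ?e0 ?e1 /=; ring.
Qed.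

Lemma quaternion_mulE : @quaternion_mul R = cayley_dickson (@complex_mul R).
Proof.
apply/boolp.funext => x; apply/boolp.funext => y; apply/(@rowP R (2 + 2)) => l.
have e0 : lshift 2 (0 : 'I_2) = 0 :> 'I_4 by apply/val_inj.
have e1 : lshift 2 (1 : 'I_2) = 1 :> 'I_4 by apply/val_inj.
have e2 : rshift 2 (0 : 'I_2) = 2 :> 'I_4 by apply/val_inj.
have e3 : rshift 2 (1 : 'I_2) = 3 :> 'I_4 by apply/val_inj.
have I2 (j : 'I_2) : j = 0 \/ j = 1.
  by case: j => [[|[|//]]] j2; [left|right]; apply/val_inj.
rewrite /cayley_dickson; case: (split_ordP l) => j ->.
  rewrite row_mxEl; case: (I2 j) => ->;
    rewrite !mxE !hconj_coord !mxE ?e0 ?e1 ?e2 ?e3 /=; ring.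
rewrite row_mxEr; case: (I2 j) => ->;
  rewrite !mxE !hconj_coord !mxE ?e0 ?e1 ?e2 ?e3 /=; ring.
Qed.

Lemma real_mulA : associative (@real_mul R).
Proof. by move=> x y z; apply/rowP => l; rewrite !mxE mulrA. Qed.

Lemma complex_mulA : associative (@complex_mul R).
Proof.
by move=> x y z; apply/rowP => -[[|[|//]] l2]; rewrite !mxE /=; ring.
Qed.

Lemma quaternion_mulA : associative (@quaternion_mul R).
Proof.
by move=> x y z; apply/rowP => -[[|[|[|[|//]]]] l4]; rewrite !mxE /=; ring.
Qed.

Lemma quaternion_mul_noncomm : ~ commutative (@quaternion_mul R).
Proof.
move=> /(_ (delta_mx 0 1) (delta_mx 0 2)) /rowP/(_ 3).
rewrite !mxE /= !(mulr0, mul0r, mulr1, addr0, add0r, subr0, sub0r) => /eqP.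
by rewrite eq_sym -subr_eq0 -opprD oppr_eq0 -[_ + _]/(2%:R) pnatr_eq0.
Qed.

Lemma complex_hurwitz : euclidean_hurwitz (@complex_mul R).
Proof.
rewrite complex_mulE.
by apply: (cayley_dickson_hurwitz _ real_hurwitz) => //; exact: real_mulA.
Qed.

Lemma quaternion_hurwitz : euclidean_hurwitz (@quaternion_mul R).
Proof.
rewrite quaternion_mulE.
by apply: (cayley_dickson_hurwitz _ complex_hurwitz) => //; exact: complex_mulA.
Qed.

Lemma octonion_hurwitz : euclidean_hurwitz (@octonion_mul R).
Proof.
rewrite octonion_mulE.
apply: (cayley_dickson_hurwitz _ quaternion_hurwitz) => //.
exact: quaternion_mulA.
Qed.

Lemma octonion_mul_nonassoc : ~ associative (@octonion_mul R).
Proof.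
rewrite octonion_mulE => /(cayley_dickson_assoc_comm quaternion_hurwitz).
exact: quaternion_mul_noncomm.
Qed.

Lemma real_embedding n (mul : 'rV[R]_n -> 'rV[R]_n -> 'rV[R]_n) :
  (0 < n)%N -> euclidean_hurwitz mul ->
  hurwitz_embedding (@real_mul R) mul (scalar_vec n 1).
Proof.
move=> n_gt0 H.
have line (x : 'rV[R]_1) : x *m scalar_vec n 1 = x 0 0 *: scalar_vec n 1.
  by rewrite [x in LHS]mx11_scalar mul_scalar_mx.
split=> [x y||x y]; rewrite !line.
- by rewrite (hmulZl H) (hmulZr H) (hmul1l H) scalerA mxE.
- by rewrite mxE scale1r.
- by rewrite !dot_linear dot_one // mulr1 dotE big_ord1.
Qed.

End Classical.

Theorem theorem1 (R : realType) :
  [/\ euclidean_hurwitz (@real_mul R),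
      euclidean_hurwitz (@complex_mul R),
      euclidean_hurwitz (@quaternion_mul R) &
      euclidean_hurwitz (@octonion_mul R)] /\
  (forall (n : nat) (mul : 'rV[R]_n -> 'rV[R]_n -> 'rV[R]_n),
     (1 <= n)%N -> euclidean_hurwitz mul ->
     [\/ algebra_isomorphic mul (@real_mul R),
         algebra_isomorphic mul (@complex_mul R),
         algebra_isomorphic mul (@quaternion_mul R) |
         algebra_isomorphic mul (@octonion_mul R)]).
Proof.
split.
  split; [exact: real_hurwitz|exact: complex_hurwitz
         |exact: quaternion_hurwitz|exact: octonion_hurwitz].
move=> n mul n_gt0 H.
have embR : exists M, hurwitz_embedding (@real_mul R) mul M.
  by exists (scalar_vec n 1); exact: real_embedding.
have [//||embC] := embedding_iso_or_double _ n_gt0 H embR; first exact: Or41.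
rewrite -complex_mulE in embC.
have [//||embH] := embedding_iso_or_double _ n_gt0 H embC; first exact: Or42.
rewrite -quaternion_mulE in embH.
have [//||embO] := embedding_iso_or_double _ n_gt0 H embH; first exact: Or43.
rewrite -octonion_mulE in embO.
have [//||embS] := embedding_iso_or_double _ n_gt0 H embO; first exact: Or44.
case: (@octonion_mul_nonassoc R).
exact: cayley_dickson_embedding_assoc (octonion_hurwitz R) H embS.
Qed.
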